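(* Let $R$ be a polynomial ring over a field. Let $I\subseteq R$ be a linearly presented, equigenerated monomial ideal of degree $d$. Assume that $I=J+K$, where $J$ and $K$ are monomial ideals with $\beta_{1,d+1}(K)=0$. Let $\mathfrak a$ be (a sequence) regular on $R/I$. Then $\mathfrak a$ is regular on $R/J$ if and only if $\mathfrak a$ is regular on $R/(J:g)$ for all $g\in G(K)$.
   Context: $G(K)$ is the minimal monomial generating set of $K$. ''Equigenerated of degree $d$'' means all minimal generators have degree $d$; ''linearly presented'' means all minimal first syzygies on the minimal generators are linear. $\beta_{1,d+1}(K)$ is the graded Betti number of $K$ as a module, so $\beta_{1,d+1}(K)=0$ says that $K$ has no linear relations on its generators. A sequence $\mathfrak a=a_1,\dots,a_s$ is regular on a module $N$ if each $a_i$ is a nonzerodivisor on $N/(a_1,\dots,a_{i-1})N$. *)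

(* Defs.v *)
From HB Require Import structures.
From mathcomp Require Import all_boot all_order all_algebra.
From Stdlib Require Classical_Prop.
From mathcomp.multinomials Require Import freeg mpoly.

Set Implicit Arguments.
Unset Strict Implicit.
Unset Printing Implicit Defensive.

Import GRing.Theory.
Local Open Scope ring_scope.

(* Ideals are Prop-valued predicates, compared extensionally; the unit ideal
   is allowed. *)
Section Ideals.
Variable A : comNzRingType.
Implicit Types (I J S : A -> Prop).

Definition same_ideal I J := forall x, I x <-> J x.

Definition is_ideal I :=
  [/\ I 0, forall x y, I x -> I y -> I (x + y)
    & forall c x, I x -> I (c * x)].

Definition ideal_gen S : A -> Prop :=
  fun x => forall I, is_ideal I -> (forall y, S y -> I y) -> I x.

Definition ideal_add I J : A -> Prop :=
  fun x => exists y z, [/\ I y, J z & x = y + z].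

Definition colon I (g : A) : A -> Prop := fun x => I (x * g).

(* [a] is a nonzerodivisor on the module A/I; on the zero module everything
   is. *)
Definition nonzerodivisor_mod I (a : A) := forall x, I (a * x) -> I x.

(* Regularity of a_1, ..., a_s on N = A/I: the module N/(a_1, ..., a_(i-1))N
   is A/(I + (a_1, ..., a_(i-1))).  There is no requirement that
   N/(a_1, ..., a_s)N be nonzero. *)
Definition regular_on_quotient I (a : seq A) :=
  forall i, (i < size a)%N ->
    nonzerodivisor_mod
      (ideal_add I (ideal_gen (fun x => x \in take i a))) a`_i.

End Ideals.

Section Monomial.
Variables (k : fieldType) (n : nat).
Local Notation R := {mpoly k[n]}.
Implicit Types (I : R -> Prop) (M : 'X_{1..n} -> Prop).

Definition gen_by_monomials M : R -> Prop :=
  ideal_gen (fun x => exists2 m, M m & x = 'X_[m]).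

Definition monomial_ideal I := exists M, same_ideal I (gen_by_monomials M).

(* G(I): the monomials of I that are minimal for divisibility, which is
   [(_ <= _)%MM] on exponents.  By [gen_min_gens] and [min_gens_least] below,
   this is the least set of monomials generating I. *)
Definition min_gens I : 'X_{1..n} -> Prop :=
  fun m => I 'X_[m] /\ forall m', I 'X_[m'] -> (m' <= m)%MM -> m' = m.

Definition equigenerated I (d : nat) := forall m, min_gens I m -> mdeg m = d.

(* The free R-module on all monomials; the source of the presentation
   F_0 -> I is its submodule with basis G(I). *)
Local Notation F := {freeg 'X_{1..n} / R}.

Definition syzygy I (s : F) :=
  (forall m, m \in dom s -> min_gens I m) /\
  \sum_(m <- dom s) coeff m s * 'X_[m] = 0.

(* The basis element of F indexed by m has degree [mdeg m]. *)
Definition homog_syz (j : nat) (s : F) :=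
  forall m, coeff m s * 'X_[m] \is j.-homog.

(* (x_1, ..., x_n) Syz(I) *)
Definition nonminimal_syzygy I (s : F) :=
  exists t : 'I_n -> F,
    (forall i, syzygy I (t i)) /\ s = \sum_i ('X_i : R) *: t i.

Definition linear_syz (s : F) := forall m, coeff m s \is 1.-homog.

(* The homogeneous syzygies that can belong to a minimal homogeneous
   generating set of Syz(I) are those outside (x_1, ..., x_n) Syz(I). *)
Definition linearly_presented I :=
  forall (j : nat) (s : F),
    syzygy I s -> homog_syz j s -> ~ nonminimal_syzygy I s -> linear_syz s.

(* b = beta_(1,j)(I), the number of elements of degree j in a minimal
   homogeneous generating set of Syz(I): the t_i are homogeneous of degree j
   and induce a k-basis of the degree j part of
   Syz(I) / (x_1, ..., x_n) Syz(I). *)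
Definition graded_betti1 I (j b : nat) :=
  exists t : 'I_b -> F,
    [/\ forall i, syzygy I (t i) /\ homog_syz j (t i),
        forall c : 'I_b -> k,
          nonminimal_syzygy I (\sum_i ((c i)%:MP : R) *: t i) ->
          forall i, c i = 0
      & forall s, syzygy I s -> homog_syz j s ->
          exists c : 'I_b -> k,
            nonminimal_syzygy I (s - \sum_i ((c i)%:MP : R) *: t i)].

Lemma ideal_gen_ideal (S : R -> Prop) : is_ideal (ideal_gen S).
Proof.
split=> [I [] //|x y hx hy I hI hS|c x hx I hI hS]; case: (hI) => _ hD hM.
- by apply: hD; [apply: hx|apply: hy].
- by apply: hM; apply: hx.
Qed.

Lemma mem_gen_by_monomials M (p : R) : gen_by_monomials M p ->
  forall u, u \in msupp p -> exists2 m, M m & (m <= u)%MM.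
Proof.
move/(_ (fun p => forall u, u \in msupp p -> exists2 m, M m & (m <= u)%MM)).
apply=> [|y [m Mm ->] u]; last first.
  by rewrite msuppX inE => /eqP->; exists m => //; apply: lepm_refl.
split=> [u|x y hx hy u|c x hx u]; first by rewrite msupp0.
  by move/msuppD_le; rewrite mem_cat => /orP[]; [apply: hx|apply: hy].
move/msuppM_le => /allpairsP[[u1 u2] /= [_ /hx [m Mm le_m] ->]].
by exists m => //; apply: (lepm_trans le_m); apply: lem_addl.
Qed.

Lemma gen_by_monomials_le M m m' :
  M m -> (m <= m')%MM -> gen_by_monomials M 'X_[m'].
Proof.
move=> Mm le I [_ _ hM] hS; rewrite -(submK le) mpolyXD.
by apply: hM; apply: hS; exists m.
Qed.

Lemma min_gens_least I M :
  same_ideal I (gen_by_monomials M) -> forall m, min_gens I m -> M m.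
Proof.
move=> eI m [/eI Im mmin].
have [m0 Mm0 le0] : exists2 m0, M m0 & (m0 <= m)%MM.
  by apply: (mem_gen_by_monomials Im); rewrite msuppX inE.
rewrite -(mmin m0) //; apply/eI.
exact: gen_by_monomials_le Mm0 (lepm_refl _).
Qed.

Lemma min_gens_below I m :
  I 'X_[m] -> exists2 m0, min_gens I m0 & (m0 <= m)%MM.
Proof.
have [b] := ubnP (mdeg m); elim: b => // b IHb in m *; rewrite ltnS => mb Im.
have [[m' [Im' le_m neq]]|no] := Classical_Prop.classic
    (exists m', [/\ I 'X_[m'], (m' <= m)%MM & m' != m]); last first.
  exists m; last exact: lepm_refl.
  split=> // m' Im' le_m; apply/eqP/negPn/negP => neq.
  by apply: no; exists m'.
have lt_m : (mdeg m' < mdeg m)%N; last first.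
  have [m0 Gm0 le0] := IHb m' (leq_trans lt_m mb) Im'.
  by exists m0 => //; apply: lepm_trans le0 le_m.
rewrite -(submK le_m) mdegD -[X in (X < _)%N]add0n ltn_add2r lt0n mdeg_eq0.
by apply: contraNneq neq => e0; rewrite -(submK le_m) e0 add0m.
Qed.

Lemma gen_min_gens I :
  monomial_ideal I -> same_ideal I (gen_by_monomials (min_gens I)).
Proof.
move=> [M eI] x; split; last first.
  have [i0 iD iM] := ideal_gen_ideal
    (fun x : R => exists2 m, M m & x = 'X_[m]).
  apply=> [|y [m [Im _] ->] //].
  split; first exact/eI.
    by move=> y z /eI hy /eI hz; apply/eI; apply: iD.
  by move=> c y /eI hy; apply/eI; apply: iM.
move=> /eI; apply; first exact: ideal_gen_ideal.
move=> y [m Mm ->].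
have /min_gens_below[m0 Gm0] : I 'X_[m].
  by apply/eI; apply: gen_by_monomials_le Mm (lepm_refl _).
exact: gen_by_monomials_le.
Qed.

End Monomial.

(* Main.v *)
(* For u a monomial outside J, every syzygy of I vanishes in multidegree u:
   such a syzygy is generated by linear ones, and in a multidegree outside J
   the generators involved all lie in G(K), which has no linear relations.
   Applied to the relation between two distinct g, h in G(K), this shows that
   every common multiple of g and h lies in J, so that I/J is the direct sum of
   the cyclic modules R/(J : g), g in G(K).  The sequence a being regular on
   R/I, the exact sequence 0 -> I/J -> R/J -> R/I -> 0 shows that a is regular
   on R/J if and only if it is regular on I/J. *)
Require Import Defs.
From HB Require Import structures.
From mathcomp Require Import all_boot all_order all_algebra.
From Stdlib Require Classical_Prop.
From mathcomp.multinomials Require Import freeg mpoly.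
From mathcomp Require Import ring.

Set Implicit Arguments.
Unset Strict Implicit.
Unset Printing Implicit Defensive.

Import GRing.Theory.
Local Open Scope ring_scope.

(** * Ideals and regular sequences in a commutative ring *)

Section RegularSequences.
Variable A : comNzRingType.
Implicit Types (I J S : A -> Prop) (a : seq A).

Lemma ideal0 I : is_ideal I -> I 0.
Proof. by case. Qed.

Lemma idealD I x y : is_ideal I -> I x -> I y -> I (x + y).
Proof. by case=> _ hD _; apply: hD. Qed.

Lemma idealMl I c x : is_ideal I -> I x -> I (c * x).
Proof. by case=> _ _; apply. Qed.

Lemma idealN I x : is_ideal I -> I x -> I (- x).
Proof. by rewrite -mulN1r; apply: idealMl. Qed.

Lemma idealB I x y : is_ideal I -> I x -> I y -> I (x - y).
Proof. by move=> hI Ix Iy; apply: idealD (idealN hI Iy). Qed.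

Lemma ideal_sum I (T : eqType) (s : seq T) (F : T -> A) :
  is_ideal I -> (forall i, i \in s -> I (F i)) -> I (\sum_(i <- s) F i).
Proof.
move=> hI hF; rewrite big_seq; apply: big_ind => //.
  exact: ideal0.
by move=> x y; apply: idealD.
Qed.

Lemma is_ideal_gen S : is_ideal (ideal_gen S).
Proof.
split=> [I hI _|x y hx hy I hI hS|c x hx I hI hS]; first exact: ideal0.
  by apply: idealD; [|apply: hx|apply: hy].
by apply: idealMl; last apply: hx.
Qed.

Lemma mem_ideal_gen S x : S x -> ideal_gen S x.
Proof. by move=> Sx I _; apply. Qed.

Lemma is_ideal_add I J : is_ideal I -> is_ideal J -> is_ideal (ideal_add I J).
Proof.
move=> hI hJ; split=> [|_ _ [x [y [Ix Jy ->]]] [x' [y' [Ix' Jy' ->]]]|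
                        c _ [x [y [Ix Jy ->]]]].
- by exists 0, 0; split; [exact: ideal0|exact: ideal0|rewrite addr0].
- by exists (x + x'), (y + y'); split; [exact: idealD|exact: idealD|ring].
- by exists (c * x), (c * y); split; [exact: idealMl|exact: idealMl|ring].
Qed.

Lemma ideal_addl I J x : is_ideal J -> I x -> ideal_add I J x.
Proof. by move=> hJ Ix; exists x, 0; split; [|exact: ideal0|rewrite addr0]. Qed.

Lemma ideal_addr I J x : is_ideal I -> J x -> ideal_add I J x.
Proof. by move=> hI Jx; exists 0, x; split; [exact: ideal0| |rewrite add0r]. Qed.

(** For [I] the unit ideal [fun=> True], this is the principal ideal of [g]. *)
Definition ideal_scale I g : A -> Prop := fun x => exists2 b, I b & x = b * g.

Lemma is_ideal_scale I g : is_ideal I -> is_ideal (ideal_scale I g).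
Proof.
move=> hI; split=> [|_ _ [b Ib ->] [c Ic ->]|c _ [b Ib ->]].
- by exists 0; rewrite ?mul0r //; apply: ideal0.
- by exists (b + c); rewrite ?mulrDl //; apply: idealD.
- by exists (c * b); rewrite ?mulrA //; apply: idealMl.
Qed.

Definition ideal_mul I J : A -> Prop :=
  ideal_gen (fun x => exists b c, [/\ I b, J c & x = b * c]).

Lemma ideal_mulM I J b c : I b -> J c -> ideal_mul I J (b * c).
Proof. by move=> Ib Jc; apply: mem_ideal_gen; exists b, c. Qed.

Lemma ideal_mul_subl I J x : is_ideal I -> ideal_mul I J x -> I x.
Proof.
by move=> hI; apply=> // _ [b [c [Ib _ ->]]]; rewrite mulrC; apply: idealMl.
Qed.

Lemma ideal_mulSl I I' J x :
  (forall y, I y -> I' y) -> ideal_mul I J x -> ideal_mul I' J x.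
Proof.
move=> sI; apply; first exact: is_ideal_gen.
by move=> _ [b [c [/sI I'b Jc ->]]]; apply: ideal_mulM.
Qed.

(** The ideal (a_1, ..., a_i), in the form to which [regular_on_quotient] unfolds. *)
Definition initial_ideal a i : A -> Prop := ideal_gen (fun x => x \in take i a).

Lemma initial_idealS a i x : (i < size a)%N -> initial_ideal a i.+1 x ->
  ideal_add (initial_ideal a i) (ideal_scale (fun=> True) a`_i) x.
Proof.
move=> lt_i; have hA := is_ideal_gen (fun x => x \in take i a).
have hR : is_ideal (fun _ : A => True) by [].
apply; first exact: is_ideal_add (is_ideal_scale _ hR).
move=> y; rewrite (take_nth 0) // mem_rcons inE => /orP[/eqP->|ay].
  by apply: ideal_addr => //; exists 1; rewrite ?mul1r.
by apply: ideal_addl (mem_ideal_gen ay); apply: is_ideal_scale.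
Qed.

Lemma initial_ideal_subS a i x :
  (i < size a)%N -> initial_ideal a i x -> initial_ideal a i.+1 x.
Proof.
move=> lt_i; apply; first exact: is_ideal_gen.
move=> y ay; apply: mem_ideal_gen.
by rewrite (take_nth 0) // mem_rcons inE ay orbT.
Qed.

Lemma mem_initial_idealS a i : (i < size a)%N -> initial_ideal a i.+1 a`_i.
Proof.
by move=> lt_i; apply: mem_ideal_gen; rewrite (take_nth 0) // mem_rcons mem_head.
Qed.

(* For ideals J, I with J contained in I: the sequence a is regular on the
   module N = I/J, as N/(a_1, ..., a_(i-1))N is I/(J + (a_1, ..., a_(i-1))I). *)
Definition regular_on_subquotient J I a := forall i, (i < size a)%N ->
  forall x, I x -> ideal_add J (ideal_mul (initial_ideal a i) I) (a`_i * x) ->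
  ideal_add J (ideal_mul (initial_ideal a i) I) x.

(** * From A/J to its submodule I/J *)

Section ShortExact.
Variables (J I : A -> Prop) (a : seq A).
Hypotheses (hI : is_ideal I) (sJI : forall x, J x -> I x).
Hypothesis regI : regular_on_quotient I a.

Let hA i : is_ideal (initial_ideal a i) := is_ideal_gen _.
Let hAI i : is_ideal (ideal_mul (initial_ideal a i) I) := is_ideal_gen _.

(* Since a is regular on A/I, tensoring 0 -> I/J -> A/J -> A/I -> 0 with
   A/(a_1, ..., a_i) preserves injectivity on the left. *)
Lemma initial_ideal_cap i x : (i <= size a)%N -> I x ->
  ideal_add J (initial_ideal a i) x ->
  ideal_add J (ideal_mul (initial_ideal a i) I) x.
Proof.
elim: i x => [|i IHi] x le_i Ix [j [y [Jj Ay def_x]]].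
  exists j, 0; split=> //; first exact: ideal0.
  (* For i = 0 the initial ideal lies in the zero ideal, so [y] vanishes. *)
  rewrite def_x; congr (_ + _); apply: (Ay (eq^~ 0)); last by rewrite take0.
  by split=> // [u v -> ->|c u ->]; rewrite ?addr0 ?mulr0.
have [y0 [_ [Ay0 [r _ ->] def_y]]] := initial_idealS le_i Ay.
(* Modulo (a_1, ..., a_i), the next element of [a] times [r] equals [x - j], which lies in I;
   regularity on A/I then puts [r] in I up to [w]. *)
have [|z [w [Iz Aw def_r]]] := regI le_i (x := r).
  exists (x - j), (- y0); split.
  - by apply: idealB => //; apply: sJI.
  - exact: idealN (hA i) Ay0.
  - by rewrite def_x def_y; ring.
(* Subtracting the multiple of [z] brings x into J + (a_1, ..., a_i) without leaving I, so induction
   applies. *)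
have [||j' [v [Jj' Av def_v]]] := IHi (x - a`_i * z) (ltnW le_i).
- by apply: idealB => //; apply: idealMl.
- exists j, (y0 + a`_i * w).
  split; [by []|exact: idealD (hA i) Ay0 (idealMl _ (hA i) Aw)|].
  by rewrite def_x def_y def_r; ring.
exists j', (v + a`_i * z); split=> //; last by rewrite addrA -def_v subrK.
apply: (idealD (hAI i.+1)).
  by apply: ideal_mulSl Av => ?; apply: initial_ideal_subS.
by apply: ideal_mulM => //; apply: mem_initial_idealS.
Qed.

(** In both directions [initial_ideal_cap] passes from J + (a_1, ..., a_i) to J + (a_1, ..., a_i)I.
    For the converse, regularity on A/I first replaces [x] by an element [z] of I. *)
Lemma regular_on_subquotientP :
  regular_on_quotient J a <-> regular_on_subquotient J I a.
Proof.
split=> reg i lt_i x => [Ix [j [y [Jj Ay def_x]]]|[j [y [Jj Ay def_x]]]].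
  apply: initial_ideal_cap => //; first exact: ltnW.
  by apply: reg => //; exists j, y; split=> //; apply: ideal_mul_subl Ay.
have [|z [w [Iz Aw def_z]]] := regI lt_i (x := x).
  by exists j, y; split=> //; apply: sJI.
have [|j' [y' [Jj' Ay' def_y']]] := reg i lt_i z Iz.
- apply: initial_ideal_cap => //; [exact: ltnW|exact: idealMl|].
  exists j, (y - a`_i * w); split=> //.
    exact: idealB (hA i) Ay (idealMl _ (hA i) Aw).
  by rewrite addrA -def_x def_z; ring.
exists j', (y' + w); split=> //; last by rewrite def_z def_y'; ring.
by apply: (idealD (hA i)) => //; apply: ideal_mul_subl Ay'.
Qed.

End ShortExact.

(** * Regularity on a direct sum of cyclic modules *)

Section DirectSum.
Variables (T : eqType) (P : T -> Prop) (e : T -> A) (J I : A -> Prop).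
Hypotheses (hJ : is_ideal J) (hI : is_ideal I).

Definition ideal_without g : A -> Prop :=
  ideal_add J (ideal_gen (fun x => exists h, [/\ P h, h != g & x = e h])).

Lemma is_ideal_without g : is_ideal (ideal_without g).
Proof. by apply: is_ideal_add => //; apply: is_ideal_gen. Qed.

(** The indices are kept distinct so that the term of a single [g] can be isolated. *)
Lemma ideal_gen_combination x :
  ideal_gen (fun y => exists2 g, P g & y = e g) x ->
  exists (s : seq T) (r : T -> A),
    [/\ uniq s, forall g, g \in s -> P g & x = \sum_(g <- s) r g * e g].
Proof.
pose Q y := exists (s : seq T) (r : T -> A),
  [/\ uniq s, forall g, g \in s -> P g & y = \sum_(g <- s) r g * e g].
move/(_ Q); apply=> [|y [g Pg ->]]; last first.
  exists [:: g], (fun => 1); split=> // [h|]; first by rewrite inE => /eqP->.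
  by rewrite big_seq1 mul1r.
split=> [|y z [s [r [us Ps ->]]] [s' [r' [us' Ps' ->]]]|c y [s [r [us Ps ->]]]].
- by exists [::], (fun => 0); split=> //; rewrite big_nil.
(* To add two combinations, extend both by zero coefficients to the union of their index lists. *)
- have widen (t : seq T) (q : T -> A) : uniq t -> {subset t <= s ++ s'} ->
    \sum_(g <- t) q g * e g =
    \sum_(g <- undup (s ++ s')) (if g \in t then q g else 0) * e g.
    move=> ut st; rewrite [RHS](bigID (mem t)) /= [X in _ + X]big1 ?addr0.
      rewrite -[RHS]big_filter [RHS](perm_big t).
        by apply: eq_big_seq => g ->.
      apply: uniq_perm => // [|g]; first exact: filter_uniq (undup_uniq _).
      by rewrite mem_filter mem_undup; case: (boolP (g \in t)) => //= /st.
    by move=> g /negbTE->; rewrite mul0r.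
  exists (undup (s ++ s')), (fun g => (if g \in s then r g else 0) +
                                     (if g \in s' then r' g else 0)).
  split=> [|g|]; first exact: undup_uniq.
    by rewrite mem_undup mem_cat => /orP[/Ps|/Ps'].
  under [RHS]eq_bigr => g _ do rewrite mulrDl.
  rewrite big_split /= -!widen // => g; rewrite mem_cat => ->//.
  by rewrite orbT.
- exists s, (fun g => c * r g); split=> //.
  by rewrite mulr_sumr; apply: eq_bigr => g _; rewrite mulrA.
Qed.

(** Together with [indep], this makes I/J the internal direct sum of the cyclic modules generated by
    the [e g], each isomorphic to A/(J : e g). *)
Hypothesis defI :
  same_ideal I (ideal_add J (ideal_gen (fun x => exists2 g, P g & x = e g))).
Hypothesis indep : forall g r, P g -> ideal_without g (r * e g) -> J (r * e g).

Lemma split_off g x :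
  I x -> ideal_add (ideal_without g) (ideal_scale (fun=> True) (e g)) x.
Proof.
have hR : is_ideal (fun _ : A => True) by [].
have hL := is_ideal_without g; have hE := is_ideal_scale (e g) hR.
have hLE := is_ideal_add hL hE.
move=> /defI [j [y [Jj Ky ->]]]; apply: idealD => //.
  by apply: ideal_addl => //; apply: ideal_addl => //; apply: is_ideal_gen.
apply: Ky => // _ [h Ph ->]; have [->|neq] := eqVneq h g.
  by apply: ideal_addr => //; exists 1; rewrite ?mul1r.
apply: ideal_addl => //; apply: ideal_addr => //; apply: mem_ideal_gen.
by exists h.
Qed.

(* The projection of I/J onto its summand A/(J : e g), modulo B. *)
Lemma colon_component B g x l : is_ideal B -> P g -> ideal_without g l ->
  ideal_add J (ideal_mul B I) (x * e g + l) -> ideal_add (colon J (e g)) B x.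
Proof.
move=> hB Pg Ll [j [y [Jj BIy def_x]]].
have hL := is_ideal_without g; have hE := is_ideal_scale (e g) hB.
(* Splitting each factor from I along [g] leaves a coefficient of [e g] that lies in B. *)
have [l' [_ [Ll' [b Bb ->] def_y]]] :
    ideal_add (ideal_without g) (ideal_scale B (e g)) y.
  apply: BIy; first exact: is_ideal_add.
  move=> _ [b [c [Bb /(split_off g) [l' [_ [Ll' [r _ ->] ->]]] ->]]].
  exists (b * l'), (b * r * e g); split; [exact: idealMl| |ring].
  by exists (b * r) => //; rewrite mulrC; apply: idealMl.
exists (x - b), b; split=> //; last by rewrite subrK.
apply: indep => //; have -> : (x - b) * e g = j + l' - l.
  by rewrite mulrBl -[x * e g](addrK l) def_x def_y; ring.
apply: idealB => //; apply: idealD => //.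
by apply: ideal_addl => //; apply: is_ideal_gen.
Qed.

Lemma mem_generator g : P g -> I (e g).
Proof.
by move=> Pg; apply/defI/ideal_addr => //; apply: mem_ideal_gen; exists g.
Qed.

(** Regularity is tested on each summand: from left to right on the multiples of a single [e g],
    from right to left on the terms of a finite combination. *)
Lemma regular_on_direct_sum a :
  regular_on_subquotient J I a <->
  forall g, P g -> regular_on_quotient (colon J (e g)) a.
Proof.
have hJA i : is_ideal (ideal_add J (ideal_mul (initial_ideal a i) I)).
  by apply: is_ideal_add => //; apply: is_ideal_gen.
have hA i : is_ideal (initial_ideal a i) := is_ideal_gen _.
have scale i g x : P g -> ideal_add (colon J (e g)) (initial_ideal a i) x ->
    ideal_add J (ideal_mul (initial_ideal a i) I) (x * e g).
  move=> Pg [j [y [Jj Ay ->]]]; exists (j * e g), (y * e g).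
  by split=> //; [apply: ideal_mulM => //; apply: mem_generator|rewrite mulrDl].
split=> reg => [g Pg i lt_i x cx|i lt_i x Ix ax].
  have L0 : ideal_without g 0 by exact: ideal0 (is_ideal_without g).
  apply: (colon_component (hA i) Pg L0); rewrite addr0.
  apply: (reg i lt_i); first exact: idealMl _ hI (mem_generator Pg).
  by rewrite mulrA; apply: (scale i) Pg cx.
have /defI [j [_ [Jj /ideal_gen_combination [s [r [us Ps ->]]] def_x]]] := Ix.
rewrite def_x; apply: idealD => //.
  by apply: ideal_addl => //; apply: is_ideal_gen.
apply: ideal_sum => // g sg; apply: (scale i g _ (Ps g sg)).
apply: (reg g (Ps g sg) i lt_i).
(* Here [l] collects the terms of the product other than that of [g]; the projection kills it. *)
apply: (colon_component (hA i) (Ps g sg)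
  (l := a`_i * (j + \sum_(h <- s | h != g) r h * e h))).
  apply: idealMl; first exact: is_ideal_without.
  apply: idealD; first exact: is_ideal_without.
    by apply: ideal_addl => //; apply: is_ideal_gen.
  rewrite -big_filter; apply: ideal_sum; first exact: is_ideal_without.
  move=> h; rewrite mem_filter => /andP[neq sh].
  apply: idealMl; first exact: is_ideal_without.
  apply: ideal_addr => //; apply: mem_ideal_gen.
  by exists h; split=> //; apply: Ps.
move: ax; rewrite def_x (bigD1_seq g) //=; congr (ideal_add _ _ _); ring.
Qed.

End DirectSum.
End RegularSequences.

(** * Monomial ideals and multigraded syzygies *)

Section MonomialIdeals.
Variables (k : fieldType) (n : nat).
Local Notation R := {mpoly k[n]}.
Local Notation F := {freeg 'X_{1..n} / R}.
Implicit Types (I J K : R -> Prop) (m u g h : 'X_{1..n}).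

Lemma mcoeffMX_le (p : R) m u :
  (p * 'X_[m])@_u = if (m <= u)%MM then p@_(u - m) else 0.
Proof.
case: ifPn => [/submK def_u|le_m].
  by rewrite -{1}def_u addmC mcoeffMX.
apply: memN_msupp_eq0; rewrite (perm_mem (msuppMX p m)).
by apply: contra le_m => /mapP[v _ ->]; apply: lem_addr.
Qed.

Lemma is_ideal_monomial I : monomial_ideal I -> is_ideal I.
Proof.
move=> [M eI]; have hM := is_ideal_gen (fun x : R => exists2 m, M m & x = 'X_[m]).
split=> [|x y /eI Ix /eI Iy|c x /eI Ix]; apply/eI; first exact: ideal0 hM.
  exact: idealD hM Ix Iy.
exact: idealMl hM Ix.
Qed.

Lemma monomial_ideal_up I m u :
  is_ideal I -> (m <= u)%MM -> I 'X_[m] -> I 'X_[u].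
Proof. by move=> hI /submK <- Im; rewrite mpolyXD; apply: idealMl. Qed.

Lemma mem_monomial_ideal I p :
  is_ideal I -> (forall u, u \in msupp p -> I 'X_[u]) -> I p.
Proof.
move=> hI Ip; rewrite [p]mpolyE; apply: ideal_sum => // u /Ip Iu.
by rewrite -mul_mpolyC; apply: idealMl.
Qed.

Lemma msupp_monomial_ideal I p :
  monomial_ideal I -> I p -> forall u, u \in msupp p -> I 'X_[u].
Proof.
move=> [M eI] /eI Ip u /(mem_gen_by_monomials Ip) [m Mm le_m].
by apply/eI; apply: gen_by_monomials_le Mm le_m.
Qed.

Lemma syzygy_sum_widen (s : F) (r : seq 'X_{1..n}) :
  uniq r -> {subset dom s <= r} ->
  \sum_(m <- dom s) coeff m s * 'X_[m] = \sum_(m <- r) coeff m s * 'X_[m].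
Proof.
move=> ur sr; rewrite [RHS](bigID (mem (dom s))) /= [X in _ + X]big1 ?addr0.
  rewrite -[RHS]big_filter; apply: perm_big; apply: uniq_perm => [||m].
  - exact: uniq_dom.
  - exact: filter_uniq.
  - by rewrite mem_filter; case: (boolP (m \in dom s)) => //= /sr.
by move=> m sm; rewrite coeff_outdom ?mul0r.
Qed.

(** The component of multidegree [u] of [t], where the basis element indexed by [m] has multidegree
    [m]. *)
Definition multi_component u (t : F) : F :=
  \sum_(m <- dom t)
    << (if (m <= u)%MM then (coeff m t)@_(u - m) *: 'X_[u - m] else 0) *g m >>.

Lemma coeff_multi_component u t m :
  coeff m (multi_component u t) =
  if (m <= u)%MM then (coeff m t)@_(u - m) *: 'X_[u - m] else 0.
Proof.
rewrite /multi_component raddf_sum /=.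
have [tm|tm] := boolP (m \in dom t).
  rewrite (bigD1_seq m) ?uniq_dom //= coeffU eqxx mulr1 big1 ?addr0 //.
  by move=> h neq; rewrite coeffU (negbTE neq) mulr0.
rewrite (coeff_outdom tm) mcoeff0 scale0r if_same big_seq big1 // => h th.
by rewrite coeffU; case: eqP tm => [<-|_ _]; rewrite ?th ?mulr0.
Qed.

Lemma multi_componentX u t m :
  coeff m (multi_component u t) * 'X_[m] =
  (coeff m t * 'X_[m])@_u *: 'X_[u].
Proof.
rewrite coeff_multi_component mcoeffMX_le; case: ifP => [le_m|_].
  by rewrite -scalerAl -mpolyXD submK.
by rewrite mul0r scale0r.
Qed.

Lemma dom_multi_component u t : {subset dom (multi_component u t) <= dom t}.
Proof.
move=> m; rewrite !mem_dom; apply: contraNN => /eqP t0.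
by rewrite coeff_multi_component t0 mcoeff0 scale0r if_same.
Qed.

Lemma homog_multi_component u t : homog_syz (mdeg u) (multi_component u t).
Proof.
by move=> m; rewrite multi_componentX; apply: dhomogZ; rewrite dhomogX.
Qed.

(** The map from F to R respects multidegrees, so it kills each component of a syzygy. *)
Lemma syzygy_multi_component I u t : syzygy I t -> syzygy I (multi_component u t).
Proof.
move=> [It t0]; split=> [m /dom_multi_component /It //|].
rewrite (syzygy_sum_widen (uniq_dom t) (@dom_multi_component u t)).
under eq_bigr do rewrite multi_componentX.
by rewrite -scaler_suml -raddf_sum t0 raddf0 scale0r.
Qed.

Lemma coeff_nonminimal (t : 'I_n -> F) m v :
  (coeff m (\sum_i ('X_i : R) *: t i))@_v =
  \sum_i (if (U_(i) <= v)%MM then (coeff m (t i))@_(v - U_(i)) else 0).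
Proof.
rewrite !raddf_sum; apply: eq_bigr => i _ /=.
by rewrite [coeff _ _]coeff_fgscale mulrC mcoeffMX_le.
Qed.

(* The constant term of the coefficient of g is the coefficient of 'X_[g] in
   the relation: no other minimal generator divides 'X_[g]. *)
Lemma syzygy_coeff0 K t g : syzygy K t -> min_gens K g -> (coeff g t)@_0 = 0.
Proof.
move=> [Kt t0] [Kg gmin]; have [tg|/coeff_outdom->] := boolP (g \in dom t).
  have := congr1 (mcoeff g) t0; rewrite raddf0 raddf_sum /=.
  rewrite (bigD1_seq g) ?uniq_dom //= mcoeffMX_le lepm_refl.
  have -> : (g - g = 0)%MM by rewrite -{1}[g]add0m addmK.
  rewrite big_seq_cond big1 ?addr0 // => m /andP[/Kt [Km _] neq].
  by rewrite mcoeffMX_le; case: ifP => // /(gmin _ Km) /eqP; rewrite (negbTE neq).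
by rewrite mcoeff0.
Qed.

(** * Syzygies in multidegrees outside J *)

Section Splitting.
Variables (d : nat) (I J K : R -> Prop).
Hypotheses (lpI : linearly_presented I) (eqI : equigenerated I d).
Hypotheses (mJ : monomial_ideal J) (mK : monomial_ideal K).
Hypotheses (defI : same_ideal I (ideal_add J K)) (bK : graded_betti1 K d.+1 0).

Let hJ := is_ideal_monomial mJ.
Let hK := is_ideal_monomial mK.

Lemma splitting_subl p : J p -> I p.
Proof. by move=> Jp; apply/defI/ideal_addl. Qed.

Lemma splitting_subr p : K p -> I p.
Proof. by move=> Kp; apply/defI/ideal_addr. Qed.

Lemma splitting_monomial u : I 'X_[u] -> J 'X_[u] \/ K 'X_[u].
Proof.
move=> /defI [p [q [Jp Kq def_u]]].
have : u \in msupp ('X_[u] : R) by rewrite msuppX mem_head.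
rewrite {1}def_u => /msuppD_le; rewrite mem_cat => /orP[]; [left|right].
  exact: msupp_monomial_ideal Jp _ _.
exact: msupp_monomial_ideal Kq _ _.
Qed.

(** A monomial of I dividing [g] cannot lie in J, so it lies in K, where [g] is minimal. *)
Lemma splitting_min_gens g : min_gens K g -> ~ J 'X_[g] -> min_gens I g.
Proof.
move=> [Kg gmin] nJg; split=> [|m Im le_m]; first exact: splitting_subr.
have [/(monomial_ideal_up hJ le_m) //|Km] := splitting_monomial Im.
exact: gmin.
Qed.

Lemma splitting_min_gens_inv m : min_gens I m -> ~ J 'X_[m] -> min_gens K m.
Proof.
move=> [/splitting_monomial [//|Km] mmin] _; split=> // m' /splitting_subr.
exact: mmin.
Qed.

(** All generators dividing [u] are outside J, so the component of [t] in multidegree [u] is a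
    linear relation on G(K). *)
Lemma linear_syzygy_coeff_eq0 u t g :
  mdeg u = d.+1 -> ~ J 'X_[u] -> syzygy I t -> min_gens K g -> mdeg g = d ->
  (g <= u)%MM -> (coeff g t)@_(u - g) = 0.
Proof.
move=> deg_u nJu It Kg deg_g le_g; pose s := multi_component u t.
have [Is s0] := syzygy_multi_component u It.
have Ks : syzygy K s.
  split=> // m sm; apply: splitting_min_gens_inv (Is m sm) _.
  have le_m : (m <= u)%MM.
    apply: contraTT sm; rewrite mem_dom coeff_multi_component => /negbTE->.
    by rewrite eqxx.
  by move=> /(monomial_ideal_up hJ le_m).
(* The family [b] is empty, so [s] itself lies in (x_1, ..., x_n) Syz(K). *)
have [b [_ _ bs]] := bK.
have := homog_multi_component u t; rewrite deg_u => /(bs _ Ks) [c].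
rewrite big_ord0 subr0 => -[q [Kq def_s]].
have -> : (coeff g t)@_(u - g) = (coeff g s)@_(u - g).
  by rewrite coeff_multi_component le_g mcoeffZ mcoeffX eqxx mulr1.
have deg1 : mdeg (u - g)%MM = 1%N.
  by apply/eqP; rewrite -(eqn_add2r (mdeg g)) -mdegD submK // deg_u deg_g.
(* As [u - g] has degree 1, removing a variable leaves only constant terms of syzygies of K. *)
rewrite def_s coeff_nonminimal big1 // => i _; case: ifP => // le_i.
have -> : (u - g - U_(i))%MM = 0%MM.
  apply/eqP; rewrite -mdeg_eq0 -(eqn_add2r (mdeg U_(i)%MM)) -mdegD submK //.
  by rewrite deg1 mdeg1.
exact: syzygy_coeff0 (Kq i) Kg.
Qed.

(* By induction on mdeg u: the component of t of multidegree u either lies in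
   (x_1, ..., x_n) Syz(I), or is linear, hence a linear relation on G(K). *)
Lemma syzygy_coeff_eq0 u t g :
  ~ J 'X_[u] -> syzygy I t -> (g <= u)%MM -> (coeff g t)@_(u - g) = 0.
Proof.
have [j] := ubnP (mdeg u); elim: j => // j IHj in u t *; rewrite ltnS => le_u.
move=> nJu It le_g; pose s := multi_component u t.
have Is : syzygy I s := syzygy_multi_component u It.
have cs : (coeff g t)@_(u - g) = (coeff g s)@_(u - g).
  by rewrite coeff_multi_component le_g mcoeffZ mcoeffX eqxx mulr1.
have [[q [Iq def_s]]|min_s] := Classical_Prop.classic (nonminimal_syzygy I s).
  (* Each summand is a coefficient of a syzygy in multidegree [u - U_(i)], still outside J. *)
  rewrite cs def_s coeff_nonminimal big1 // => i _; case: ifP => // le_i.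
  have le_iu : (U_(i) <= u)%MM := lepm_trans le_i (lem_subr _ _).
  have -> : (u - g - U_(i) = (u - U_(i)) - g)%MM by rewrite !submDA addmC.
  apply: IHj => //.
  - by apply: leq_trans le_u; rewrite -{2}(submK le_iu) mdegD mdeg1 addn1.
  - by move=> /(monomial_ideal_up hJ (lem_subr u U_(i))).
  - apply/mnm_lepP=> l; move/mnm_lepP/(_ l): le_i; move/mnm_lepP/(_ l): le_g.
    rewrite !mnmBE => le_gl; rewrite leq_subRL // => le_gi.
    by rewrite leq_subRL 1?addnC // (leq_trans _ le_gi) ?leq_addl.
have [//|c_neq0] := eqVneq (coeff g t)@_(u - g) 0.
have tg : g \in dom t.
  by apply: contraNT c_neq0 => /coeff_outdom->; rewrite mcoeff0.
have Ig : min_gens I g by case: It => /(_ g tg).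
have Kg : min_gens K g.
  by apply: splitting_min_gens_inv => // /(monomial_ideal_up hJ le_g).
have deg_g := eqI Ig.
(* It remains to see that [u] has degree d + 1: [s] is linear by [lpI], so [u - g] has degree 1. *)
apply: linear_syzygy_coeff_eq0 => //.
have /dhomogP/(_ (u - g)%MM) := lpI Is (homog_multi_component u t) min_s g.
rewrite mcoeff_msupp -cs c_neq0 => /(_ isT) deg1.
by rewrite -(submK le_g) mdegD deg_g [X in (X + _)%N]deg1.
Qed.

(** Otherwise the binomial relation between [g] and [h] in multidegree [u] would be a syzygy of I
    whose coefficient at [g] is a nonzero monomial. *)
Lemma lcm_min_gens u g h : min_gens K g -> min_gens K h -> g != h ->
  (g <= u)%MM -> (h <= u)%MM -> J 'X_[u].
Proof.
move=> Kg Kh neq le_g le_h; apply: Classical_Prop.NNPP => nJu.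
have Ig : min_gens I g.
  by apply: splitting_min_gens => // /(monomial_ideal_up hJ le_g).
have Ih : min_gens I h.
  by apply: splitting_min_gens => // /(monomial_ideal_up hJ le_h).
pose s : F := << ('X_[u - g] : R) *g g >> - << ('X_[u - h] : R) *g h >>.
have cs m : coeff m s = 'X_[u - g] * (g == m)%:R - 'X_[u - h] * (h == m)%:R.
  by rewrite coeffB !coeffU.
have ds : {subset dom s <= [:: g; h]}.
  move=> m; rewrite mem_dom cs !inE ![m == _]eq_sym.
  by apply: contraNT => /norP[/negbTE-> /negbTE->]; rewrite !mulr0 subr0.
have Is : syzygy I s.
  split=> [m /ds|]; first by rewrite !inE => /orP[] /eqP->.
  rewrite (syzygy_sum_widen _ ds) ?big_cons ?big_nil /= ?inE ?neq //.
  rewrite !cs !eqxx (negbTE neq) eq_sym (negbTE neq) !mulr0 !mulr1 subr0 sub0r.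
  by rewrite mulNr -!mpolyXD !submK // addr0 subrr.
have := syzygy_coeff_eq0 nJu Is le_g; rewrite cs eqxx eq_sym (negbTE neq).
by rewrite mulr1 mulr0 subr0 mcoeffX eqxx => /eqP; rewrite oner_eq0.
Qed.

(** Checked on monomials: each monomial of the product is a multiple of [g], and is in J or is also
    a multiple of another generator of K, hence in J by [lcm_min_gens]. *)
Lemma min_gens_independent g (r : R) : min_gens K g ->
  ideal_without (min_gens K) (fun m => 'X_[m]) J g (r * 'X_[g]) -> J (r * 'X_[g]).
Proof.
move=> Kg [j [y [Jj Ly def_r]]].
have mL : gen_by_monomials (fun h => min_gens K h /\ h != g) y.
  apply: Ly; first exact: is_ideal_gen.
  by move=> _ [h [Kh neq ->]]; apply: mem_ideal_gen; exists h.
apply: mem_monomial_ideal => // u ru.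
have le_g : (g <= u)%MM.
  by move: ru; rewrite (perm_mem (msuppMX r g)) => /mapP[v _ ->]; apply: lem_addr.
move: ru; rewrite def_r => /msuppD_le; rewrite mem_cat => /orP[].
  exact: msupp_monomial_ideal.
move=> /(mem_gen_by_monomials mL) [h [Kh neq] le_h].
exact: lcm_min_gens neq le_h le_g.
Qed.

Lemma splitting_gens :
  same_ideal I (ideal_add J (gen_by_monomials (min_gens K))).
Proof.
move=> x; split.
  move=> /defI [y [z [Jy Kz ->]]]; exists y, z; split=> //.
  exact/(gen_min_gens mK).
move=> [y [z [Jy Kz ->]]]; apply/defI; exists y, z; split=> //.
exact/(gen_min_gens mK).
Qed.

End Splitting.
End MonomialIdeals.

(** * Regularity on R/J, read on the summands of I/J *)

Theorem corollary5p4 (k : fieldType) (n d : nat)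
    (I J K : {mpoly k[n]} -> Prop) (a : seq {mpoly k[n]}) :
  monomial_ideal I -> linearly_presented I -> equigenerated I d ->
  monomial_ideal J -> monomial_ideal K ->
  same_ideal I (ideal_add J K) ->
  graded_betti1 K d.+1 0 ->
  regular_on_quotient I a ->
  (regular_on_quotient J a <->
   forall g : 'X_{1..n}, min_gens K g ->
     regular_on_quotient (colon J 'X_[g]) a).
Proof.
move=> mI lpI eqI mJ mK defI bK regI.
have [hI hJ] := (is_ideal_monomial mI, is_ideal_monomial mJ).
rewrite (regular_on_subquotientP hI (splitting_subl mK defI) regI).
apply: (@regular_on_direct_sum _ _ (min_gens K) (fun m => 'X_[m])) => //.
  exact: splitting_gens.
exact: (min_gens_independent lpI eqI mJ mK defI bK).
Qed.
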